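(* Let $i\in\{7,23\}$ and $n$ a positive integer. Then $\mathcal{J}_{10}(40n+i)$ and $\mathcal{J}^*_{10}(40n+i)$ are both even.
   Context: Let $q=e^{2\pi i\tau}$, $(a;q)_\infty=\prod_{j\ge0}(1-aq^j)$, and $\eta(\tau)=q^{1/24}(q;q)_\infty$. Define $$j_{10}(\tau)=\frac{\eta(2\tau)\eta(5\tau)^5}{\eta(\tau)\eta(10\tau)^5}-1=\frac1q+\sum_{n\ge0}\mathcal{J}_{10}(n)q^n,$$ $$j_{10}^{*}(\tau)=\left(\frac{\eta(\tau)\eta(5\tau)}{\eta(2\tau)\eta(10\tau)}\right)^{4}+4+2^4\left(\frac{\eta(2\tau)\eta(10\tau)}{\eta(\tau)\eta(5\tau)}\right)^{4}=\frac1q+\sum_{n\ge0}\mathcal{J}^*_{10}(n)q^n.$$ *)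

(* Defs.v *)
From mathcomp Require Import all_boot all_order all_algebra.
Set Implicit Arguments. Unset Strict Implicit. Unset Printing Implicit Defensive.
Import Order.TTheory GRing.Theory Num.Theory.
Local Open Scope ring_scope.

Definition series := nat -> int.

Definition smul (f g : series) : series :=
  fun n => \sum_(i < n.+1) f i * g (n - i)%N.

Definition sone : series := fun n => if n == 0%N then 1 else 0.

Fixpoint spow (f : series) (e : nat) : series :=
  match e with 0%N => sone | e'.+1 => smul f (spow f e') end.

(* Multiplicative inverse of a series with constant term 1:
   g_0 = 1, g_n = - sum_{k=1}^n f_k g_{n-k}. *)
Fixpoint sinv_upto (f : series) (n : nat) : seq int :=
  match n with
  | 0%N => [:: 1]
  | n'.+1 => let s := sinv_upto f n' in
             rcons s (- \sum_(1 <= k < n'.+2) f k * nth 0 s (n'.+1 - k)%N)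
  end.
Definition sinv (f : series) : series := fun n => nth 0 (sinv_upto f n) n.

(* (q^k; q^k)_infty = prod_{j >= 1} (1 - q^{k j}), k >= 1. The coefficient of
   q^m only depends on the factors with j <= m. *)
Definition qpoch (k : nat) : series :=
  fun m => (\prod_(j < m) (1 - 'X^(k * j.+1)) : {poly int})`_m.

(* q^{-1} * eta(2t) eta(5t)^5 / (eta(t) eta(10t)^5) as a power series in q *)
Definition j10_series : series :=
  smul (smul (qpoch 2) (spow (qpoch 5) 5))
       (sinv (smul (qpoch 1) (spow (qpoch 10) 5))).

(* j10 = 1/q + sum_{n>=0} J10(n) q^n *)
Definition J10 (n : nat) : int := j10_series n.+1 - (n == 0%N)%:R.

(* A = (q;q)(q^5;q^5)/((q^2;q^2)(q^10;q^10)), so that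
   (eta(t)eta(5t)/(eta(2t)eta(10t)))^4 = q^{-1} A^4 *)
Definition Aser : series :=
  smul (smul (qpoch 1) (qpoch 5)) (sinv (smul (qpoch 2) (qpoch 10))).

(* j10* = q^{-1} A^4 + 4 + 16 q A^{-4} = 1/q + sum_{n>=0} J10star(n) q^n *)
Definition J10star (n : nat) : int :=
  spow Aser 4 n.+1 + 4 * (n == 0%N)%:R
  + 16 * (if n is n'.+1 then sinv (spow Aser 4) n' else 0).

(* Main.v *)
(**
  Write f_k for (q^k; q^k)_oo; modulo 2 one has f_k^2 = f_{2k}, and Euler's
  pentagonal number theorem shows that the exponents of f_1 lie in {0, 1, 2}
  modulo 5.

  Modulo 2, q (j_10 + 1) = f_1 / f_5^5, so its exponents avoid the classes 3 and 4
  modulo 5, which contain 40n + 8 and 40n + 24.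

  Modulo 2, q j*_10 = B with (f_1 f_5)^8 B = (f_1 f_5)^4. The even part of
  f_1 f_5 is (f_1 f_2)(q^2) modulo 2, so the series B' formed by the
  coefficients of B at multiples of 8 satisfies f_1 f_5 B' = f_1 f_2, that is
  B' = f_2 / f_5, whose exponents avoid the classes 1 and 3 modulo 5,
  where 40n + 8 = 8 (5n + 1) and 40n + 24 = 8 (5n + 3).

  The claim on the even part of f_1 f_5 is a parity statement on lattice points.
  By the pentagonal number theorem, its coefficient at 2M counts solutions of
  a^2 + 5 b^2 = 8M + 1 with a - b = 1 mod 6, and the coefficient of f_1 f_2 at M
  counts solutions of a^2 + 8 b^2 = 8M + 1 with a + 2b = 1 mod 6. Each of these is,
  up to a global sign, the set of all solutions minus those in a sublattice of
  index 3. On all solutions b -> -b is an involution whose fixed points have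
  b = 0; on the sublattice an automorphism of the induced form is an involution
  without fixed points. So both counts have the parity of the number of
  a > 0 with a^2 = 8M + 1.
*)
Require Import Defs.
From mathcomp Require Import all_boot all_order all_algebra.
From mathcomp Require Import zify ring.
Set Implicit Arguments. Unset Strict Implicit. Unset Printing Implicit Defensive.
Import Order.TTheory GRing.Theory Num.Theory.
Local Open Scope ring_scope.

(** * Counting with involutions *)

(** The points moved by [f] pair off as x, f x. The induction removes one fixed point or one such
    pair at a time. *)
Lemma odd_size_involution (T : eqType) (s : seq T) (f : T -> T) :
  uniq s -> {in s, forall x, f x \in s} -> {in s, involutive f} ->
  odd (size s) = odd (count (fun x => f x == x) s).
Proof.
have [n] := ubnP (size s); elim: n s => // n IHn [|x s] //= lt_s /andP[xNs Us] fS fK.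
have fxS : f x \in x :: s by apply: fS; rewrite inE eqxx.
have ffx : f (f x) = x by apply: fK; rewrite inE eqxx.
have [fxx | fxNx] := eqVneq (f x) x.
  rewrite add1n /= (IHn s) //.
  - move=> y sy; have := fS y; rewrite !inE sy orbT => /(_ isT) /predU1P[fyx|//].
    by move: xNs; rewrite -fxx -fyx fK ?inE ?sy ?orbT // => /negP.
  - by move=> y sy; apply: fK; rewrite inE sy orbT.
have fxs : f x \in s by move: fxS; rewrite inE (negbTE fxNx).
pose t := rem (f x) s.
have Ht := perm_to_rem fxs; rewrite -/t in Ht.
rewrite add0n (perm_size Ht) (seq.permP Ht) /= ffx eq_sym (negbTE fxNx) add0n negbK.
have := Us; rewrite (perm_uniq Ht) /= => /andP[fxNt Ut].
have st y : y \in t -> y \in s by rewrite (perm_mem Ht) inE orbC => ->.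
apply: IHn => //.
- by move: lt_s; rewrite (perm_size Ht) /=; lia.
- move=> y ty; have sy := st y ty; have := fS y; rewrite !inE sy orbT => /(_ isT).
  case/predU1P=> [fyx|].
    by move: fxNt; rewrite -fyx fK ?ty // inE sy orbT.
  rewrite (perm_mem Ht) inE => /predU1P[fyx|//].
  have : f (f y) = f (f x) by rewrite fyx.
  rewrite ffx fK ?inE ?sy ?orbT // => eyx.
  by move: xNs; rewrite -eyx sy.
- by move=> y ty; apply: fK; rewrite inE st ?orbT.
Qed.

Lemma size_sign_choice (T : eqType) (s : seq T) (f : T -> T) (P : pred T) :
  uniq s -> {in s, forall x, f x \in s} -> {in s, involutive f} ->
  {in s, forall x, P (f x) = ~~ P x} -> size s = (count P s).*2.
Proof.
move=> Us fS fK PN.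
have Umap : uniq (map f s).
  by rewrite map_inj_in_uniq // => x y sx sy exy; rewrite -(fK x) // exy fK.
have Hp : perm_eq (map f s) s.
  apply: uniq_perm => // x; apply/mapP/idP => [[y sy ->]|sx]; first exact: fS.
  by exists (f x); rewrite ?fS ?fK.
have : count P s = count (predC P) s.
  by rewrite -(seq.permP Hp P) count_map; apply: eq_in_count => x sx /=; rewrite PN.
by move=> e; rewrite -(count_predC P s) -e addnn.
Qed.

(** * Finite boxes of lattice points *)

(** Each step adds the indices n and -n, in parallel with the two terms that [shanks] gains in its
    induction. *)
Fixpoint zball (n : nat) : seq int :=
  if n is n'.+1 then n%:Z :: - n%:Z :: zball n' else [:: 0].

Lemma mem_zball n (x : int) : (x \in zball n) = (`|x| <= n)%N.
Proof. by elim: n => [|n IHn] /=; rewrite !inE ?IHn; lia. Qed.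

Lemma zball_uniq n : uniq (zball n).
Proof. by elim: n => [|n IHn] //=; rewrite IHn !inE !mem_zball; lia. Qed.

Definition zbox (n : nat) : seq (int * int) := [seq (x, y) | x <- zball n, y <- zball n].

Lemma mem_zbox n (p : int * int) : (p \in zbox n) = (`|p.1| <= n)%N && (`|p.2| <= n)%N.
Proof.
case: p => x y; rewrite -!mem_zball /=.
apply/allpairsP/andP => [[[u v] /= [Hu Hv [-> ->]]] // | [Hx Hy]].
by exists (x, y).
Qed.

Lemma zbox_uniq n : uniq (zbox n).
Proof. by apply: allpairs_uniq; rewrite ?zball_uniq //; move=> [? ?] [? ?] _ _ [-> ->]. Qed.

Lemma odd_count_involution (T : eqType) (s : seq T) (P : pred T) (f : T -> T) :
  uniq s -> {in s, forall x, P x -> f x \in s /\ P (f x)} ->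
  {in s, forall x, P x -> f (f x) = x} ->
  odd (count P s) = odd (count (fun x => P x && (f x == x)) s).
Proof.
move=> Us fS fK; rewrite -size_filter (@odd_size_involution _ _ f) ?filter_uniq //.
- by rewrite count_filter; congr odd; apply: eq_count => x /=; rewrite andbC.
- by move=> x; rewrite !mem_filter => /andP[Px sx]; have [-> ->] := fS _ sx Px.
- by move=> x; rewrite mem_filter => /andP[Px sx]; apply: fK.
Qed.

Lemma count_sign_choice (T : eqType) (s : seq T) (f : T -> T) (A P : pred T) :
  uniq s -> {in s, forall x, f x \in s} -> {in s, involutive f} ->
  {in s, forall x, A (f x) = A x} ->
  {in s, forall x, A x -> P (f x) = ~~ P x} ->
  count A s = (count (predI A P) s).*2.
Proof.
move=> Us fS fK fA fP; rewrite -size_filter.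
rewrite (@size_sign_choice _ _ f P) ?filter_uniq ?count_filter //.
- by congr _.*2; apply: eq_count => x /=; rewrite andbC.
- by move=> x; rewrite !mem_filter => /andP[Ax sx]; rewrite fA // Ax fS.
- by move=> x; rewrite mem_filter => /andP[_ sx]; apply: fK.
- by move=> x; rewrite mem_filter => /andP[Ax sx]; apply: fP.
Qed.

(** * Solutions of a^2 + c b^2 = w *)

Definition negp (p : int * int) : int * int := (- p.1, - p.2).
Definition conjp (p : int * int) : int * int := (p.1, - p.2).

Definition norm_reps (c : int) (w : nat) : seq (int * int) :=
  [seq p <- zbox w | p.1 ^+ 2 + c * p.2 ^+ 2 == w%:Z].

(** As |x| <= x^2 and c >= 1, every integer solution lies in the box, so the list is complete. *)
Lemma mem_norm_reps (c : int) (w : nat) p :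
  0 < c -> (p \in norm_reps c w) = (p.1 ^+ 2 + c * p.2 ^+ 2 == w%:Z).
Proof.
move=> c0; rewrite mem_filter mem_zbox; case: p => a b /=.
apply: andb_idr => /eqP E.
have le_sqr (x : int) : (`|x|%N%:Z <= x ^+ 2) by nia.
have [Ha Hb] := (le_sqr a, le_sqr b); have b2 : 0 <= b ^+ 2 by nia.
by apply/andP; split; nia.
Qed.

Lemma norm_reps_uniq c w : uniq (norm_reps c w).
Proof. by rewrite filter_uniq // zbox_uniq. Qed.

(* [S] and [Q] choose one of each pair of opposite solutions outside and inside
   the sublattice [D]. *)
Lemma odd_count_norm_reps (c : int) (w : nat) (D S Q : pred (int * int))
    (g : int * int -> int * int) :
  0 < c -> {in norm_reps c w, forall p : int * int, p.1 != 0} ->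
  {in norm_reps c w, forall p, D (negp p) = D p} ->
  {in norm_reps c w, forall p, S p -> ~~ D p} ->
  {in norm_reps c w, forall p, ~~ D p -> S (negp p) = ~~ S p} ->
  {in norm_reps c w, forall p, D p -> Q (negp p) = ~~ Q p} ->
  {in norm_reps c w, forall p, D p ->
     [/\ g p \in norm_reps c w, D (g p), Q (g p) = Q p, g (g p) = p & g p != p]} ->
  odd (count S (norm_reps c w)) =
  odd (count (fun p : int * int => (0 < p.1) && (p.2 == 0)) (norm_reps c w)).
Proof.
move=> c0 a_n0 DN SD SN QN gP; set T := norm_reps c w.
have UT : uniq T := norm_reps_uniq c w.
have negT : {in T, forall p, negp p \in T}.
  by move=> p; rewrite !mem_norm_reps //= !sqrrN.
have negK : {in T, involutive negp}.
  by move=> [a b] _; rewrite /negp /= !opprK.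
have ET : size T = (count (fun p : int * int => 0 < p.1) T).*2.
  apply: (size_sign_choice UT negT negK) => p Tp; have /= := a_n0 _ Tp.
  by rewrite oppr_gt0 -leNgt lt_neqAle => ->.
have ED : count D T = (count (predI D Q) T).*2.
  by apply: (count_sign_choice UT negT negK).
have ES : count (predC D) T = (count S T).*2.
  rewrite (count_sign_choice (P := S) UT negT negK).
  - by congr _.*2; apply: eq_in_count => p Tp /=; case: (boolP (S p)) => [/SD->|]; rewrite ?andbF.
  - by move=> p Tp /=; rewrite DN.
  - by move=> p Tp /=; apply: SN.
(* Halving |T| = |D| + |T \ D| splits the solutions with a > 0 into those in [S] and one half of
   [D]. *)
have := count_predC D T; rewrite ED ES ET => EQ.
have {}EQ : count (fun p : int * int => 0 < p.1) T = (count S T + count (predI D Q) T)%N by lia.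
(* That half of [D] is even in number, since [g] preserves it and moves each of its points. *)
have Z0 : odd (count (predI D Q) T) = false.
  rewrite (@odd_count_involution _ _ _ g) //.
  - rewrite (@eq_in_count _ _ pred0) ?count_pred0 // => p Tp /=.
    by case: (boolP (D p)) => //= Dp; have [_ _ _ _ /negbTE->] := gP _ Tp Dp; rewrite andbF.
  - by move=> p Tp /= /andP[Dp Qp]; have [-> -> ->] := gP _ Tp Dp.
  - by move=> p Tp /= /andP[Dp Qp]; have [_ _ _ ->] := gP _ Tp Dp.
have : odd (count (fun p : int * int => 0 < p.1) T) = odd (count S T).
  by rewrite EQ oddD Z0 addbF.
move=> <-; rewrite (@odd_count_involution _ _ _ conjp) //.
- by congr odd; apply: eq_count => -[a b]; rewrite /conjp xpair_eqE eqxx /=; congr (_ && _); lia.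
- by move=> p; rewrite !mem_norm_reps //= sqrrN.
- by move=> [a b] _ _; rewrite /conjp /= opprK.
Qed.

(** * Pentagonal numbers and the two lattice point counts *)

(** Generalised pentagonal numbers. The division is exact and the value nonnegative, so [absz] only
    changes the type. *)
Definition pent (k : int) : nat := absz (k * (3 * k + 1) %/ 2)%Z.

Lemma pentE k : (pent k)%:Z * 2 = k * (3 * k + 1).
Proof.
have e : (2 %| k * (3 * k + 1))%Z.
  have [h [->|->]] : exists h, k = 2 * h \/ k = 2 * h + 1.
    by exists (k %/ 2)%Z; lia.
    by rewrite -mulrA dvdz_mulr.
  by rewrite (_ : 3 * _ + 1 = (3 * h + 2) * 2) ?dvdz_mull //; ring.
have k0 : 0 <= k * (3 * k + 1) by nia.
rewrite /pent gez0_abs ?divz_ge0 // divzK //.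
Qed.

Lemma leq_pent k : (`|k| <= pent k)%N.
Proof. by have := pentE k; nia. Qed.

Lemma count_bij (T U : eqType) (s : seq T) (t : seq U) (P : pred T) (Q : pred U)
    (f : T -> U) (h : U -> T) : uniq s -> uniq t ->
  {in s, forall x, P x -> [/\ f x \in t, Q (f x) & h (f x) = x]} ->
  {in t, forall y, Q y -> [/\ h y \in s, P (h y) & f (h y) = y]} ->
  count P s = count Q t.
Proof.
move=> Us Ut sP tQ; rewrite -!size_filter -(size_map f).
apply/perm_size/uniq_perm; last 1 first.
- move=> y; rewrite mem_filter; apply/mapP/andP => [[x]|[Qy ty]].
    by rewrite mem_filter => /andP[Px sx] ->; have [-> ->] := sP _ sx Px.
  have [sx Px fx] := tQ _ ty Qy.
  by exists (h y); rewrite // mem_filter Px.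
- rewrite map_inj_in_uniq ?filter_uniq // => x y.
  rewrite !mem_filter => /andP[Px sx] /andP[Py sy] e.
  by have [_ _ <-] := sP _ sx Px; rewrite e; have [_ _] := sP _ sy Py.
- exact: filter_uniq.
Qed.

(* On [D], where [a = b + 3 c], the form is [6 b^2 + 6 b c + 9 c^2], invariant
   under [b -> - b - c]. *)
Lemma odd_count_pent5 (M L : nat) : (M.*2 <= L)%N ->
  odd (count (fun p => pent p.1 + 5 * pent p.2 == M.*2)%N (zbox L)) =
  odd (count (fun p : int * int => (0 < p.1) && (p.2 == 0)) (norm_reps 5 (8 * M + 1))).
Proof.
move=> leML; set w := (8 * M + 1)%N.
have wE : w%:Z = 8 * M%:Z + 1 by rewrite /w; lia.
pose S (p : int * int) := ((p.1 - p.2) %% 6 == 1)%Z.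
pose D (p : int * int) := (3 %| p.1 - p.2)%Z.
pose g (p : int * int) : int * int :=
  let c := ((p.1 - p.2) %/ 3)%Z in (2 * c - p.2, - p.2 - c).
(* Since w is odd, a and b have opposite parity; so a - b is 1, 3 or 5 modulo 6, where 3 is the case
   [D] and negation exchanges 1 and 5. *)
have oddS a b : a ^+ 2 + 5 * b ^+ 2 = w%:Z -> ((a - b) %% 2 = 1)%Z.
  move=> E; have [h Eh] : exists h, a - b = 2 * h \/ a - b = 2 * h + 1.
    by exists ((a - b) %/ 2)%Z; lia.
  case: Eh => Eh; last by lia.
  by have {}Eh : a = b + 2 * h by [lia]; subst a; lia.
transitivity (odd (count S (norm_reps 5 w))).
  (* With x = 6k + 1 and y = 6m + 1 the equation reads x^2 + 5 y^2 = 6 (8M + 1); passing to a = (x +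
     5y)/6 and b = (x - y)/6 removes the factor 6. *)
  congr odd; apply: (@count_bij _ _ _ _ _ _
    (fun p => (p.1 + 5 * p.2 + 1, p.1 - p.2))
    (fun p => let m := ((p.1 - p.2) %/ 6)%Z in (p.2 + m, m))).
  - exact: zbox_uniq.
  - exact: norm_reps_uniq.
  - move=> [k m] _ /= /eqP E; have [Ek Em] := (pentE k, pentE m).
    have e : k + 5 * m + 1 - (k - m) = 6 * m + 1 by ring.
    split; rewrite ?mem_norm_reps /S //= ?e; first by apply/eqP; nia.
    + by lia.
    + by congr (_, _); lia.
  - move=> [a b]; rewrite mem_norm_reps /S //= => /eqP E /eqP ab.
    set m := ((a - b) %/ 6)%Z; have aE : a = b + 6 * m + 1 by rewrite /m; lia.
    clearbody m; subst a; have [Ek Em] := (pentE (b + m), pentE m).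
    have P : (pent (b + m) + 5 * pent m == M.*2)%N.
      by apply/eqP; nia.
    have [lk lm] := (leq_pent (b + m), leq_pent m).
    split => //; last by congr (_, _); ring.
    by rewrite mem_zbox /=; move: (eqP P) => {}P; lia.
apply: (odd_count_norm_reps (D := D) (Q := fun p => 0 < p.1 - p.2) (g := g)) => //.
- move=> [a b]; rewrite mem_norm_reps //= => /eqP E.
  (* If a = 0, then 5 b^2 = 1 modulo 8, which no residue of b modulo 4 allows. *)
  apply/eqP => a0; subst a.
  have [h Eh] : exists h, b = 4 * h \/ b = 4 * h + 1 \/
      b = 4 * h + 2 \/ b = 4 * h + 3 by exists (b %/ 4)%Z; lia.
  by case: Eh => [|[|[]]] Eh; subst b; lia.
- by move=> [a b] _; rewrite /D /=; lia.
- by move=> [a b] _; rewrite /D /S /=; lia.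
- move=> [a b]; rewrite mem_norm_reps //= => /eqP /oddS; rewrite /D /S /=; lia.
- move=> [a b]; rewrite mem_norm_reps //= => /eqP /oddS; rewrite /D /=; lia.
move=> [a b]; rewrite mem_norm_reps // /D /g /= => /eqP E Dp.
set c := ((a - b) %/ 3)%Z; have aE : a = b + 3 * c by rewrite /c; lia.
clearbody c; subst a.
have e : 2 * c - b - (- b - c) = 3 * c by ring.
have e' : b + 3 * c - b = 3 * c by ring.
rewrite e e' mem_norm_reps //= mulKz //; split => //.
- by apply/eqP; move: E; rewrite /=; lia.
- by lia.
- by congr (_, _); ring.
- rewrite xpair_eqE; apply/negP => /andP[_ /eqP bc].
  (* At a fixed point the form is 30 b^2, which is even, whereas w is odd. *)
  have {}bc : c = - b * 2 by lia.
  by subst c; lia.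
Qed.

(* On [D], where [a = b + 3 c], the form is [9 b^2 + 6 b c + 9 c^2], invariant
   under the exchange of [b] and [c]. *)
Lemma odd_count_pent2 (M L : nat) : (M <= L)%N ->
  odd (count (fun p => pent p.1 + 2 * pent p.2 == M)%N (zbox L)) =
  odd (count (fun p : int * int => (0 < p.1) && (p.2 == 0)) (norm_reps 8 (8 * M + 1))).
Proof.
move=> leML; set w := (8 * M + 1)%N.
have wE : w%:Z = 8 * M%:Z + 1 by rewrite /w; lia.
pose S (p : int * int) := ((p.1 + 2 * p.2) %% 6 == 1)%Z.
pose D (p : int * int) := (3 %| p.1 + 2 * p.2)%Z.
pose g (p : int * int) : int * int :=
  let c := ((p.1 - p.2) %/ 3)%Z in (c + 3 * p.2, c).
have odda a b : a ^+ 2 + 8 * b ^+ 2 = w%:Z -> (a %% 2 = 1)%Z.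
  move=> E; have [h Eh] : exists h, a = 2 * h \/ a = 2 * h + 1.
    by exists (a %/ 2)%Z; lia.
  by case: Eh => Eh; subst a; lia.
transitivity (odd (count S (norm_reps 8 w))).
  (* With x = 6k + 1 and y = 6m + 1 the equation reads x^2 + 2 y^2 = 3 (8M + 1); here a = (x + 2y)/3
     and b = (y - x)/6. *)
  congr odd; apply: (@count_bij _ _ _ _ _ _
    (fun p => (4 * p.2 + 2 * p.1 + 1, p.2 - p.1))
    (fun p => let m := ((p.1 + 2 * p.2) %/ 6)%Z in (m - p.2, m))).
  - exact: zbox_uniq.
  - exact: norm_reps_uniq.
  - move=> [k m] _ /= /eqP E; have [Ek Em] := (pentE k, pentE m).
    have e : 4 * m + 2 * k + 1 + 2 * (m - k) = 6 * m + 1 by ring.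
    split; rewrite ?mem_norm_reps /S //= ?e; first by apply/eqP; nia.
    + by lia.
    + by congr (_, _); lia.
  - move=> [a b]; rewrite mem_norm_reps /S //= => /eqP E /eqP ab.
    set m := ((a + 2 * b) %/ 6)%Z; have aE : a = 6 * m + 1 - 2 * b by rewrite /m; lia.
    clearbody m; subst a; have [Ek Em] := (pentE (m - b), pentE m).
    have P : (pent (m - b) + 2 * pent m == M)%N.
      by apply/eqP; nia.
    have [lk lm] := (leq_pent (m - b), leq_pent m).
    split => //; last by congr (_, _); ring.
    by rewrite mem_zbox /=; move: (eqP P) => {}P; lia.
apply: (odd_count_norm_reps (D := D) (Q := fun p => 0 < p.1 + 2 * p.2) (g := g)) => //.
- move=> [a b]; rewrite mem_norm_reps //= => /eqP /odda; lia.
- by move=> [a b] _; rewrite /D /=; lia.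
- by move=> [a b] _; rewrite /D /S /=; lia.
- move=> [a b]; rewrite mem_norm_reps //= => /eqP /odda; rewrite /D /S /=; lia.
- move=> [a b]; rewrite mem_norm_reps //= => /eqP /odda; rewrite /D /=; lia.
move=> [a b]; rewrite mem_norm_reps // /D /g /= => /eqP E Dp.
set c := ((a - b) %/ 3)%Z; have aE : a = b + 3 * c by rewrite /c; lia.
clearbody c; subst a.
have e : c + 3 * b - c = 3 * b by ring.
have e1 : c + 3 * b + 2 * c = 3 * (b + c) by ring.
have e2 : b + 3 * c + 2 * b = 3 * (b + c) by ring.
rewrite e e1 e2 mem_norm_reps //= mulKz //; split => //.
- by apply/eqP; move: E; rewrite /=; lia.
- by lia.
(* A fixed point has b = c, where the form is 24 b^2, again even. *)
- rewrite xpair_eqE; apply/negP => /andP[_ /eqP bc].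
  by subst c; lia.
Qed.

(** At b = 0 the coefficient of b^2 disappears from the equation, so both forms have the same fixed
    points. *)
Lemma odd_count_fixed w (c d : int) : 0 < c -> 0 < d ->
  count (fun p : int * int => (0 < p.1) && (p.2 == 0)) (norm_reps c w) =
  count (fun p : int * int => (0 < p.1) && (p.2 == 0)) (norm_reps d w).
Proof.
move=> c0 d0; apply: (@count_bij _ _ _ _ _ _ id id); rewrite ?norm_reps_uniq //.
all: move=> [a b]; rewrite !mem_norm_reps //= => E /andP[a0 /eqP b0]; subst b.
all: split => //=; last by rewrite a0.
all: by move: E; rewrite expr0n !mulr0.
Qed.

Lemma odd_count_pent (M L : nat) : (M.*2 <= L)%N ->
  odd (count (fun p => pent p.1 + 5 * pent p.2 == M.*2)%N (zbox L)) =
  odd (count (fun p => pent p.1 + 2 * pent p.2 == M)%N (zbox L)).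
Proof.
move=> leML; rewrite odd_count_pent5 // odd_count_pent2; last by lia.
by congr odd; apply: odd_count_fixed.
Qed.

(** * Shanks' finite form of the pentagonal number theorem *)

Lemma bin2_double s : ('C(s.+1, 2) * 2 = s * s.+1)%N.
Proof. by elim: s => // s IHs; rewrite binS bin1; lia. Qed.

Section Pentagonal.
Variable R : comNzRingType.
Implicit Types p q r : {poly R}.

Definition euler n : {poly R} := \prod_(0 <= j < n) (1 - 'X^(j.+1)).

(* Passing from [n] to [n.+1] changes the terms of Shanks' sum by telescoping
   differences. *)
Lemma shanks_step m n : (m <= n)%N ->
  let tail s n := \prod_(s <= j < n) (1 - 'X^(j.+1)) : {poly R} in
  let t n s := (-1) ^+ s * tail s n * 'X^(s * n + 'C(s.+1, 2)) in
  \sum_(0 <= s < m.+1) t n.+1 s =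
  \sum_(0 <= s < m.+1) t n s
  - (-1) ^+ m * tail m n * 'X^(m.+1 * n.+1 + 'C(m.+1, 2)).
Proof.
move=> + tail t; elim: m => [_|m IHm lemn].
  rewrite !big_nat1 /t /tail !mul0n !mul1n !mul1r !expr0 !mulr1 big_nat_recr //=.
  by rewrite mulrBr mulr1 addn0.
rewrite [LHS]big_nat_recr //= [in RHS]big_nat_recr //= IHm ?(ltnW lemn) // /t.
have -> : tail m n = (1 - 'X^(m.+1)) * tail m.+1 n by rewrite /tail big_ltn.
have -> : tail m.+1 n.+1 = tail m.+1 n * (1 - 'X^(n.+1)) by rewrite /tail big_nat_recr.
have -> : 'C(m.+2, 2) = ('C(m.+1, 2) + m.+1)%N by rewrite binS bin1.
have -> : (m.+1 * n + ('C(m.+1, 2) + m.+1) = m.+1 * n.+1 + 'C(m.+1, 2))%N by lia.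
have -> : (m.+2 * n.+1 + ('C(m.+1, 2) + m.+1) =
  m.+1 * n.+1 + 'C(m.+1, 2) + m.+1 + n.+1)%N by lia.
rewrite addnA; set e := (m.+1 * n.+1 + 'C(m.+1, 2))%N.
rewrite (exprD 'X (e + m.+1) n.+1) (exprD 'X e m.+1) (exprS (-1)).
move: ('X^e) ('X^(m.+1)) ('X^(n.+1)) ((-1) ^+ m) (tail m.+1 n) => u v y a b.
move: (\sum_(_ <= _ < _) _) => x; ring.
Qed.

(** In passing to n + 1, the new last summand gives the term of k = n + 1 and the remainder in
    [shanks_step] that of k = -(n + 1). *)
Lemma shanks n :
  \sum_(0 <= s < n.+1) (-1) ^+ s * (\prod_(s <= j < n) (1 - 'X^(j.+1)))
     * 'X^(s * n + 'C(s.+1, 2))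
  = \sum_(k <- zball n) (-1) ^+ `|k|%N * 'X^(pent k) :> {poly R}.
Proof.
elim: n => [|n IHn].
  by rewrite big_nat1 big_seq1 big_geq // !mulr1.
rewrite big_nat_recr //= shanks_step // IHn !big_cons abszN /=.
rewrite !big_geq // !mulr1.
have [Ep En] := (pentE n.+1, pentE (- n.+1%:Z)).
have [B1 B2] := (bin2_double n, bin2_double n.+1).
have -> : (n.+1 * n.+1 + 'C(n.+2, 2) = pent n.+1)%N by nia.
have -> : (n.+1 * n.+1 + 'C(n.+1, 2) = pent (- n.+1%:Z))%N by nia.
by rewrite exprS; ring.
Qed.

(** * Congruence modulo a power of X *)

Definition eqmX N p q := forall i, (i < N)%N -> p`_i = q`_i.

Lemma eqmX_trans N q p r : eqmX N p q -> eqmX N q r -> eqmX N p r.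
Proof. by move=> pq qr i lt_i; rewrite pq ?qr. Qed.

Lemma eqmX_sym N p q : eqmX N p q -> eqmX N q p.
Proof. by move=> pq i lt_i; rewrite pq. Qed.

Lemma eqmX_mul N p p' q q' : eqmX N p p' -> eqmX N q q' -> eqmX N (p * q) (p' * q').
Proof.
move=> pp' qq' i lt_i; rewrite !coefM; apply: eq_bigr => j _.
by rewrite pp' ?qq' //; have := ltn_ord j; lia.
Qed.

Lemma eqmX_exp N p q n : eqmX N p q -> eqmX N (p ^+ n) (q ^+ n).
Proof. by move=> pq; elim: n => // n IHn; rewrite !exprS; apply: eqmX_mul. Qed.

(** A polynomial with constant term 1 is invertible modulo ['X^N]; the coefficients are compared in
    increasing order. *)
Lemma eqmX_cancel N p q r : p`_0 = 1 -> eqmX N (p * q) (p * r) -> eqmX N q r.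
Proof.
move=> p0 H i; elim/ltn_ind: i => i IHi lt_i.
have := H i lt_i; rewrite !coefM !big_ord_recl /= p0 !mul1r subn0.
rewrite (eq_bigr (fun j : 'I_i => p`_(lift ord0 j) * r`_(i - lift ord0 j))) => [/addIr//|j _].
by rewrite IHi //=; have := ltn_ord j; rewrite /bump; lia.
Qed.

Lemma eqmX_comp_Xn N d p q : (0 < d)%N -> eqmX N p q -> eqmX N (p \Po 'X^d) (q \Po 'X^d).
Proof.
move=> d0 pq i lt_i; rewrite !coef_comp_poly_Xn //; case: ifP => // _.
by apply: pq; apply: leq_ltn_trans lt_i; apply: leq_div.
Qed.

(** Division by a series in ['X^d] only combines coefficients whose indices agree modulo d, so a
    class missing from [r] is missing from the quotient. *)
Lemma coef_quotient_support N d (c : nat) p q r :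
  (0 < d)%N -> p`_0 = 1 -> eqmX N ((p \Po 'X^d) * q) r ->
  (forall i, (i %% d = c)%N -> (i < N)%N -> r`_i = 0) ->
  forall i, (i %% d = c)%N -> (i < N)%N -> q`_i = 0.
Proof.
move=> d0 p0 H r0; elim/ltn_ind => i IHi i_c lt_i.
have := H i lt_i; rewrite r0 // coefM big_ord_recl /= coef_comp_poly_Xn // dvdn0 div0n.
rewrite p0 mul1r subn0 big1 ?addr0 // => j _; rewrite /bump leq0n add1n coef_comp_poly_Xn //.
case: ifP => [dj|]; rewrite ?mul0r // IHi ?mulr0 //; have lt_ji := ltn_ord j; try by lia.
by have := modnDmr (i - j.+1) j.+1 d; rewrite (eqP dj) addn0 subnK // i_c.
Qed.

Lemma coef0_exp p n : (p ^+ n)`_0 = p`_0 ^+ n.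
Proof. by elim: n => [|n IHn]; rewrite ?expr0 ?coef1 // !exprS coef0M IHn. Qed.

(** * Coefficients of Euler's product *)

Lemma eulerS n : euler n.+1 = euler n * (1 - 'X^(n.+1)).
Proof. by rewrite /euler big_nat_recr. Qed.

Lemma coef0_euler n : (euler n)`_0 = 1.
Proof.
elim: n => [|n IHn]; first by rewrite /euler big_geq // coef1.
by rewrite eulerS coef0M IHn coefB coef1 coefXn subr0 mulr1.
Qed.

Lemma coef_euler i n : (i <= n)%N -> (euler n)`_i = (euler i)`_i.
Proof.
elim: n => [|n IHn]; first by rewrite leqn0 => /eqP->.
rewrite leq_eqVlt => /predU1P[-> // | lt_in].
by rewrite eulerS mulrBr mulr1 coefB coefMXn lt_in subr0 IHn.
Qed.

(** In Shanks' sum the term s = 0 is [euler n], and for s > 0 the exponent s n + s (s + 1)/2 exceeds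
    n. *)
Lemma pentagonal n :
  eqmX n.+1 (euler n) (\sum_(k <- zball n) (-1) ^+ `|k|%N * 'X^(pent k)).
Proof.
move=> i lt_i; rewrite -shanks big_ltn //= !mul0n mul1r mulr1 coefD.
rewrite coef_sum [X in _ + X]big_nat [X in _ + X]big1 ?addr0 // => s /andP[s0 le_sn].
by rewrite coefMXn ifT //; case: s s0 le_sn => // s _ _; rewrite binS bin1; nia.
Qed.

End Pentagonal.

(** * Formal series as truncated polynomials *)

Lemma qpoch_euler (R : comNzRingType) k m : (0 < k)%N ->
  (qpoch k m)%:~R = (euler R m \Po 'X^k)`_m.
Proof.
move=> k0; rewrite /qpoch -(coef_map (intmul 1)) /=.
suff -> n : map_poly intr (\prod_(j < n) (1 - 'X^(k * j.+1))) = euler R n \Po 'X^k by [].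
elim: n => [|n IHn]; first by rewrite big_ord0 /euler big_geq // rmorph1 comp_polyC.
rewrite big_ord_recr /= rmorphM /= IHn eulerS comp_polyM; congr (_ * _).
by rewrite rmorphB rmorph1 /= map_polyXn comp_polyB comp_polyC comp_Xn_poly -exprM.
Qed.

Lemma size_sinv_upto f n : size (sinv_upto f n) = n.+1.
Proof. by elim: n => //= n IHn; rewrite size_rcons IHn. Qed.

Lemma nth_sinv_upto f n i : (i <= n)%N -> nth 0 (sinv_upto f n) i = sinv f i.
Proof.
elim: n => [|n IHn]; first by rewrite leqn0 => /eqP->.
rewrite leq_eqVlt => /predU1P[-> // | lt_in].
by rewrite /= nth_rcons size_sinv_upto lt_in IHn.
Qed.

Lemma smul_sinv f : f 0%N = 1 -> smul f (sinv f) =1 sone.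
Proof.
move=> f0 [|n]; first by rewrite /smul big_ord1 f0.
rewrite /smul big_ord_recl /= f0 mul1r subn0 {1}/sinv /= nth_rcons size_sinv_upto ltnn eqxx.
rewrite big_add1 /= big_mkord; apply/eqP; rewrite addrC subr_eq0; apply/eqP.
apply: eq_bigr => i _; rewrite /bump leq0n add1n nth_sinv_upto //.
by rewrite subSS leq_subr.
Qed.

Section Truncation.
Variables (R : comNzRingType) (N : nat).
Implicit Types f g : series.

Definition trunc f : {poly R} := \poly_(i < N) (f i)%:~R.

Lemma coef_trunc f i : (i < N)%N -> (trunc f)`_i = (f i)%:~R.
Proof. by move=> lt_i; rewrite coef_poly lt_i. Qed.

Lemma trunc_mul f g : eqmX N (trunc (smul f g)) (trunc f * trunc g).
Proof.
move=> i lt_i; rewrite coef_trunc // coefM /smul rmorph_sum; apply: eq_bigr => j _.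
by rewrite rmorphM /= !coef_trunc //; have := ltn_ord j; lia.
Qed.

Lemma trunc_exp f e : eqmX N (trunc (spow f e)) (trunc f ^+ e).
Proof.
elim: e => [|e IHe].
  by move=> i lt_i; rewrite coef_trunc // expr0 coef1 /= /sone; case: eqP.
by rewrite exprS; apply: eqmX_trans (trunc_mul _ _) (eqmX_mul _ IHe).
Qed.

(** Quotients are described by multiplying the denominator back, so that only polynomial congruences
    occur. *)
Lemma trunc_div f g : g 0%N = 1 -> eqmX N (trunc g * trunc (smul f (sinv g))) (trunc f).
Proof.
move=> g0; apply: eqmX_trans (eqmX_mul _ (trunc_mul _ _)) _ => //.
rewrite mulrCA -[X in eqmX _ _ X]mulr1; apply: eqmX_mul => //.
apply: eqmX_trans (eqmX_sym (trunc_mul _ _)) _ => i lt_i.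
by rewrite coef_trunc // smul_sinv // coef1 /sone; case: eqP.
Qed.

Lemma trunc_qpoch k : (0 < k)%N -> eqmX N (trunc (qpoch k)) (euler R N \Po 'X^k).
Proof.
move=> k0 i lt_i; rewrite coef_trunc // qpoch_euler // !coef_comp_poly_Xn //.
case: ifP => // _; have le_i : (i %/ k <= i)%N := leq_div _ _.
by rewrite !(@coef_euler _ (i %/ k)) //; lia.
Qed.

End Truncation.

Lemma qpoch0 k : qpoch k 0 = 1.
Proof. by rewrite /qpoch big_ord0 coef1. Qed.

Lemma smul0 f g : smul f g 0 = f 0%N * g 0%N.
Proof. by rewrite /smul big_ord1. Qed.

Lemma spow0 f e : f 0%N = 1 -> spow f e 0 = 1.
Proof. by move=> f0; elim: e => //= e IHe; rewrite smul0 f0 IHe. Qed.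

(** * Arithmetic modulo 2 *)

Local Notation F2 := 'F_2.

Lemma pchar_F2 : 2%N \in [pchar F2].
Proof. exact: pchar_Fp. Qed.

Lemma pchar_polyF2 : 2%N \in [pchar {poly F2}].
Proof. by rewrite pchar_poly pchar_F2. Qed.

Lemma natr_F2 n : n%:R = (odd n)%:R :> F2.
Proof.
rewrite -{1}(odd_double_half n) natrD -mul2n natrM.
by rewrite (pcharf0 pchar_F2) mul0r addr0.
Qed.

(** Frobenius: squaring is additive in characteristic 2 and fixes the coefficients 0 and 1. *)
Lemma sqr_polyF2 (p : {poly F2}) : p ^+ 2 = p \Po 'X^2.
Proof.
elim/poly_ind: p => [|p c IHp]; first by rewrite comp_poly0 expr0n.
rewrite comp_poly_MXaddC sqrrD -[_ *+ 2]mulr_natr (pcharf0 pchar_polyF2).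
rewrite mulr0 addr0 exprMn IHp -polyC_exp; congr (_ + _%:P).
by case: c => [[|[|c]] ltc] //; apply: val_inj.
Qed.

Lemma sqr_comp_Xn (p : {poly F2}) k : (p \Po 'X^k) ^+ 2 = p \Po 'X^(2 * k).
Proof. by rewrite sqr_polyF2 -comp_polyA comp_Xn_poly -exprM. Qed.

Lemma euler_theta2 N : eqmX N (euler F2 N) (\sum_(k <- zball N) 'X^(pent k)).
Proof.
move=> i lt_i; rewrite pentagonal ?(leqW lt_i) //.
rewrite (eq_bigr (fun k => 'X^(pent k))) // => k _.
by rewrite (oppr_pchar2 pchar_polyF2) expr1n mul1r.
Qed.

Lemma coef_euler_mul N c i : (0 < c)%N -> (i < N)%N ->
  (euler F2 N * (euler F2 N \Po 'X^c))`_i =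
  (count (fun p => pent p.1 + c * pent p.2 == i)%N (zbox N))%:R.
Proof.
move=> c0 lt_i.
have := eqmX_mul (@euler_theta2 N) (eqmX_comp_Xn c0 (@euler_theta2 N)) => /(_ _ lt_i) ->.
rewrite rmorph_sum /= -sum1_count natr_sum [RHS]big_mkcond /=.
rewrite big_allpairs_dep mulr_suml coef_sum; apply: eq_bigr => k _.
rewrite mulr_sumr coef_sum; apply: eq_bigr => m _ /=.
by rewrite comp_Xn_poly -exprM -exprD coefXn [_ == i]eq_sym; case: eqP.
Qed.

(** The cube stands for f_1 f_2, because f_1^2 = f_2 modulo 2; the equality is the parity statement
    [odd_count_pent]. *)
Lemma coef_euler_even N m : (m.*2 < N)%N ->
  (euler F2 N * (euler F2 N \Po 'X^5))`_m.*2 = (euler F2 N ^+ 3)`_m.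
Proof.
move=> lt_m; rewrite (exprS (euler F2 N)) sqr_polyF2 !coef_euler_mul //; last by lia.
by rewrite natr_F2 odd_count_pent ?(ltnW lt_m) // -natr_F2.
Qed.

Lemma coef_euler_mod5 N i : (i < N)%N -> (i %% 5 \in [:: 3; 4])%N -> (euler F2 N)`_i = 0.
Proof.
move=> lt_i i5; rewrite euler_theta2 // coef_sum big1_seq // => k _; rewrite coefXn.
(* For k = 0, 1, 2, 3, 4 modulo 5, the pentagonal number is 0, 2, 2, 0, 1 modulo 5. *)
case: eqP => // ik; have Ek := pentE k; exfalso; move: i5; rewrite ik !inE.
have [h Hk] : exists h, k = 5 * h \/ k = 5 * h + 1 \/ k = 5 * h + 2 \/
  k = 5 * h + 3 \/ k = 5 * h + 4 by exists (k %/ 5)%Z; lia.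
by case: Hk => [|[|[|[]]]] Hk; subst k; lia.
Qed.

(** * Parity of the coefficients of j_10 *)

Lemma j10_coef_even m : (m %% 5 \in [:: 3; 4])%N -> (2 %| j10_series m)%Z.
Proof.
move=> m5; rewrite (dvdz_pcharf pchar_F2); apply/eqP.
pose N := m.+1; pose F := euler F2 N; pose F5 := F \Po 'X^5.
rewrite -(@coef_trunc F2 N) //.
have F10 : F \Po 'X^10 = F5 ^+ 2 by rewrite sqr_comp_Xn.
(* Modulo 2 the denominator f_1 f_10^5 is f_1 f_5^10 and the numerator f_2 f_5^5 is f_1^2 f_5^5. *)
have E : eqmX N ((F * F5 ^+ 10) * trunc F2 N j10_series) (F ^+ 2 * F5 ^+ 5).
  have D0 : smul (qpoch 1) (spow (qpoch 10) 5) 0%N = 1.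
    by rewrite smul0 spow0 ?qpoch0.
  have Q k : (0 < k)%N -> eqmX N (trunc F2 N (qpoch k)) (F \Po 'X^k) by exact: trunc_qpoch.
  have Dn : eqmX N (trunc F2 N (smul (qpoch 1) (spow (qpoch 10) 5))) (F * F5 ^+ 10).
    apply: eqmX_trans (trunc_mul _ _ _) _; apply: eqmX_mul.
      by have := Q 1%N isT; rewrite comp_polyXr.
    have -> : F5 ^+ 10 = (F \Po 'X^10) ^+ 5 by rewrite F10 -exprM.
    exact: eqmX_trans (trunc_exp _ _ _) (eqmX_exp _ (Q 10%N isT)).
  have Nm : eqmX N (trunc F2 N (smul (qpoch 2) (spow (qpoch 5) 5))) (F ^+ 2 * F5 ^+ 5).
    apply: eqmX_trans (trunc_mul _ _ _) _; rewrite sqr_polyF2; apply: eqmX_mul (Q 2%N isT) _.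
    exact: eqmX_trans (trunc_exp _ _ _) (eqmX_exp _ (Q 5%N isT)).
  apply: eqmX_trans Nm; apply: eqmX_trans (trunc_div _ _ D0).
  by apply: eqmX_mul => //; apply: eqmX_sym.
have F50 : F5`_0 = 1 by rewrite coef_comp_poly_Xn // div0n coef0_euler.
(* Cancelling f_1 f_5^5 leaves the divisor f_5^5, a series in ['X^5]. *)
have {}E : eqmX N ((F ^+ 5 \Po 'X^5) * trunc F2 N j10_series) F.
  apply: (@eqmX_cancel _ _ (F * F5 ^+ 5)).
    by rewrite coef0M coef0_exp F50 expr1n coef0_euler mulr1.
  rewrite rmorphXn /= -/F5.
  have -> : F * F5 ^+ 5 * (F5 ^+ 5 * trunc F2 N j10_series) =
     F * F5 ^+ 10 * trunc F2 N j10_series by ring.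
  by have -> : F * F5 ^+ 5 * F = F ^+ 2 * F5 ^+ 5 by ring.
apply: (coef_quotient_support _ _ E (c := m %% 5)) => // [|i im lt_i].
  by rewrite coef0_exp coef0_euler expr1n.
by rewrite coef_euler_mod5 // im.
Qed.

(** * Parity of the coefficients of j*_10 *)

(** Modulo 2, (f_1 f_5)^2 A = f_1 f_5; this is its fourth power. It is left uncancelled because the
    8th and 4th powers are series in ['X^8] and ['X^4]. *)
Lemma trunc_Aser N : let F := euler F2 N in
  eqmX N ((F * (F \Po 'X^5)) ^+ 8 * trunc F2 N (spow Aser 4)) ((F * (F \Po 'X^5)) ^+ 4).
Proof.
move=> F; set F5 := F \Po 'X^5.
have Q k : (0 < k)%N -> eqmX N (trunc F2 N (qpoch k)) (F \Po 'X^k) by exact: trunc_qpoch.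
have F10 : F \Po 'X^10 = F5 ^+ 2 by rewrite sqr_comp_Xn.
have D0 : smul (qpoch 2) (qpoch 10) 0%N = 1 by rewrite smul0 !qpoch0.
have Dn : eqmX N (trunc F2 N (smul (qpoch 2) (qpoch 10))) ((F * F5) ^+ 2).
  rewrite exprMn -F10 (sqr_polyF2 F).
  exact: eqmX_trans (trunc_mul _ _ _) (eqmX_mul (Q 2%N isT) (Q 10%N isT)).
have Nm : eqmX N (trunc F2 N (smul (qpoch 1) (qpoch 5))) (F * F5).
  apply: eqmX_trans (trunc_mul _ _ _) _; apply: eqmX_mul (Q 5%N isT).
  by have := Q 1%N isT; rewrite comp_polyXr.
have E : eqmX N ((F * F5) ^+ 2 * trunc F2 N Aser) (F * F5).
  apply: eqmX_trans Nm; apply: eqmX_trans (trunc_div _ _ D0).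
  by apply: eqmX_mul => //; apply: eqmX_sym.
have -> : (F * F5) ^+ 8 = ((F * F5) ^+ 2) ^+ 4 by rewrite -exprM.
apply: eqmX_trans (eqmX_mul _ (trunc_exp _ _ _)) _ => //.
by rewrite -exprMn; apply: eqmX_exp.
Qed.

Lemma expr4_polyF2 (p : {poly F2}) : p ^+ 4 = p \Po 'X^4.
Proof.
have -> : p ^+ 4 = (p ^+ 2) ^+ 2 by rewrite -exprM.
by rewrite (sqr_polyF2 p) sqr_comp_Xn.
Qed.

Lemma expr8_polyF2 (p : {poly F2}) : p ^+ 8 = p \Po 'X^8.
Proof.
have -> : p ^+ 8 = (p ^+ 4) ^+ 2 by rewrite -exprM.
by rewrite (expr4_polyF2 p) sqr_comp_Xn.
Qed.

(** Extracting the exponents divisible by d commutes with multiplication by a series in ['X^d]. *)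
Lemma coef_comp_Xn_mul (R : nzSemiRingType) (p q : {poly R}) d m : (0 < d)%N ->
  ((p \Po 'X^d) * q)`_(d * m) = \sum_(i < m.+1) p`_i * q`_(d * (m - i)).
Proof.
move=> d0; elim/poly_ind: p m => [|p c IHp] m.
  by rewrite comp_poly0 mul0r coef0 big1 // => i _; rewrite coef0 mul0r.
rewrite comp_poly_MXaddC mulrDl coefD coefCM.
rewrite -[_ * 'X^d * q]mulrA -(commr_polyXn q d) mulrA coefMXn.
rewrite big_ord_recl coefD coefMX coefC /= add0r subn0 addrC; congr (_ + _).
case: m => [|m]; first by rewrite muln0 d0 big_ord0.
rewrite ifF; last by rewrite mulnS; lia.
rewrite mulnS addKn IHp; apply: eq_bigr => j _.
by rewrite /bump leq0n add1n coefD coefMX coefC /= addr0 subSS.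
Qed.

Lemma Aser_coef_even m : (m %% 5 \in [:: 1; 3])%N -> (2 %| spow Aser 4 (8 * m))%Z.
Proof.
move=> m5; rewrite (dvdz_pcharf pchar_F2); apply/eqP.
pose N := (8 * m).+1; pose F := euler F2 N; pose F5 := F \Po 'X^5.
pose B := \poly_(i < m.+1) (spow Aser 4 (8 * i))%:~R : {poly F2}.
have F0 : F`_0 = 1 := coef0_euler _ _.
have F50 : F5`_0 = 1 by rewrite coef_comp_poly_Xn // div0n.
have E : eqmX m.+1 (F * F5 * B) (F ^+ 3).
  move=> i lt_i; have lt_iN : (8 * i < N)%N by rewrite /N; lia.
  have := @trunc_Aser N _ lt_iN; rewrite -/F -/F5 expr8_polyF2 expr4_polyF2.
  rewrite coef_comp_Xn_mul // coef_comp_poly_Xn //.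
  (* The coefficient of (f_1 f_5)^4 at 8i is that of f_1 f_5 at 2i, to which the even part identity
     applies. *)
  have -> : (8 * i = i.*2 * 4)%N by lia.
  rewrite dvdn_mull // mulnK // coef_euler_even; last by rewrite /N; lia.
  move=> <-; rewrite coefM; apply: eq_bigr => j _; have lt_j := ltn_ord j.
  by rewrite coef_poly coef_trunc ?ifT //; rewrite /N; lia.
have {}E : eqmX m.+1 (F5 * B) (F \Po 'X^2).
  apply: (@eqmX_cancel _ _ F) => //; rewrite mulrA -sqr_polyF2.
  by move=> i lt_i; rewrite E // exprS.
have -> : (spow Aser 4 (8 * m))%:~R = B`_m by rewrite coef_poly ltnSn.
apply: (coef_quotient_support _ _ E (c := m %% 5)) => // i im lt_i.
(* An even i in the class 1 or 3 modulo 5 has i/2 in the class 3 or 4, which f_1 avoids. *)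
rewrite coef_comp_poly_Xn //; case: ifP => // i2; apply: coef_euler_mod5; first by rewrite /N; lia.
move: m5; rewrite -im !inE; lia.
Qed.

(** * The two progressions modulo 40 *)

Theorem theorem1p6 (i n : nat) :
  (i = 7 \/ i = 23)%N -> (0 < n)%N ->
  (2 %| J10 (40 * n + i))%Z /\ (2 %| J10star (40 * n + i))%Z.
Proof.
move=> i7 n0; have iN0 : (40 * n + i == 0)%N = false by lia.
split.
  rewrite /J10 iN0 subr0; apply: j10_coef_even; rewrite !inE.
  by case: i7 => ->; lia.
rewrite /J10star iN0 mulr0 addr0.
apply: rpredD; last by exact: dvdz_mulr.
(* The shift by the pole turns 40n + i into 40n + 8 or 40n + 24, so m is 5n + 1 or 5n + 3. *)
pose m := ((40 * n + i).+1 %/ 8)%N.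
have -> : (40 * n + i).+1 = (8 * m)%N by rewrite /m; case: i7 => ->; lia.
by apply: Aser_coef_even; rewrite /m !inE; case: i7 => ->; lia.
Qed.
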